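(* For every positive rational number $C$ and every positive integer $h$ there exists a commutative graph $G$ of level $h$ with $$D_i(G)=C^i\qquad\text{for all } 1\le i\le h.$$
   Context: A directed layered graph $G$ of level $h$ has vertex set $V(G)=V_0\cup V_1\cup\dots\cup V_h$, a disjoint union of finite sets (layers), and every directed edge goes from some $V_i$ to $V_{i+1}$. For a vertex $x$, $\operatorname{im}(x)$ denotes its set of out-neighbours and $\operatorname{im}^{-1}(x)$ its set of in-neighbours. For $Z\subseteq V(G)$, $\operatorname{im}^{(i)}(Z)$ is the set of vertices $v$ for which there is a directed path with $i$ edges starting in $Z$ and ending at $v$. $G$ is a commutative (Plünnecke) graph if: (upward condition) for every edge $uv$ there is an injective map $\varphi:\operatorname{im}(v)\to\operatorname{im}(u)$ with $\varphi(x)x\in E(G)$ for all $x\in\operatorname{im}(v)$; and (downward condition) for every edge $vw$ there is an injective map $\psi:\operatorname{im}^{-1}(v)\to\operatorname{im}^{-1}(w)$ with $x\psi(x)\in E(G)$ for all $x\in\operatorname{im}^{-1}(v)$. With $V_0\neq\emptyset$, the $i$-th magnification ratio is $D_i(G)=\min_{\emptyset\neq Z\subseteq V_0}|\operatorname{im}^{(i)}(Z)|/|Z|$. *)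

(* Defs.v *)
From HB Require Import structures.
From mathcomp Require Import all_boot all_order all_algebra.

Set Implicit Arguments.
Unset Strict Implicit.
Unset Printing Implicit Defensive.

Import Order.TTheory GRing.Theory Num.Theory.
Local Open Scope ring_scope.

(* Directed layered graphs of level h: the disjoint union V_0, ..., V_h is    *)
(* encoded by the function sending each vertex to the index of its layer.     *)
Record layered_graph (h : nat) := LayeredGraph {
  vertex :> finType;
  layer_of : vertex -> 'I_h.+1;
  edge : rel vertex;
  edge_layer : forall u v : vertex,
    edge u v -> layer_of v = (layer_of u).+1 :> nat
}.

Section LayeredGraphs.
Variables (h : nat) (G : layered_graph h).
Implicit Types (u v w x : G) (Z : {set G}).

Definition layer (i : nat) : {set G} := [set x | layer_of x == i :> nat].

Definition im x : {set G} := [set y | edge x y].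
Definition inv_im x : {set G} := [set y | edge y x].

Definition iter_im (i : nat) Z : {set G} :=
  [set v | [exists z in Z, [exists p : i.-tuple G,
              path (@edge h G) z p && (last z p == v)]]].

(* In both conditions only the restriction of the map to the stated domain    *)
(* matters.                                                                   *)
Definition upward : Prop := forall u v, edge u v ->
  exists phi : G -> G,
    [/\ {in im v, forall x, phi x \in im u},
        {in im v &, injective phi}
      & {in im v, forall x, edge (phi x) x}].

Definition downward : Prop := forall v w, edge v w ->
  exists psi : G -> G,
    [/\ {in inv_im v, forall x, psi x \in inv_im w},
        {in inv_im v &, injective psi}
      & {in inv_im v, forall x, edge x (psi x)}].

Definition commutative_graph : Prop := upward /\ downward.

Definition mag_quotient (i : nat) Z : rat := #|iter_im i Z|%:R / #|Z|%:R.

(* The minimum of the quotients over the nonempty subsets of layer 0; it is   *)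
(* meaningful only when layer 0 is nonempty (layer 0 is itself the candidate  *)
(* witnessing that the minimum ranges over a nonempty family).                *)
Definition magnification (i : nat) : rat :=
  mag_quotient i
    [arg min_(Z < layer 0 | (Z != set0) && (Z \subset layer 0))
       mag_quotient i Z]%O.

End LayeredGraphs.

(* Main.v *)
Require Import Defs.
From mathcomp Require Import all_boot all_order all_algebra.
From mathcomp Require Import ring.

(* If every vertex outside the last layer has a successors and every vertex    *)
(* outside layer 0 has b predecessors, then counting edges gives               *)
(* b |im Z| >= a |Z|, with equality for a full layer, so D_i = (a / b)^i. The   *)
(* ratios a / b realized by commutative graphs of this kind are closed under   *)
(* products (layerwise product of graphs) and inverses (reversal of edges), so *)
(* by telescoping it suffices to realize (n + 1) / n for n >= 2.               *)
(* For this, layer i consists of the words of length h over Z/(n+1) whose      *)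
(* letters at positions >= i are nonzero, and u -> v, from layer i to i + 1,   *)
(* iff u and v differ at every position < i. For a path u -> v -> w and a      *)
(* position where both edges impose u <> v <> w, replacing v by u + w - v      *)
(* preserves both constraints; this gives the required injections there.       *)

Set Implicit Arguments.
Unset Strict Implicit.
Unset Printing Implicit Defensive.

Import Order.TTheory GRing.Theory Num.Theory.
Local Open Scope ring_scope.

(** Suppose all vertices have the same out-degree a and in-degree b, except where the first or last
    layer prevents it. Double counting edges makes every step multiply a set by at least a / b
    ([leq_card_im]) and a whole layer by exactly a / b ([card_layerS]), so layer 0 attains the
    minimum and [magnification_biregular] follows. The ratios so obtained form a multiplicative
    group ([realizableM], [realizableV]) containing 3/2, 4/3, 5/4, ... ([realizable_succ]). These
    generate every positive rational, since 2 = (3/2)(4/3). The word graph supplies the generators.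
    The exchange u + w - v proves commutativity wherever a letter meets the same kind of constraint
    on both edges; [word_downward] and [word_upward] treat separately the positions where a nonzero
    letter becomes free. *)

Definition biregular (h : nat) (G : layered_graph h) (a b : nat) : Prop :=
  (forall x : G, (layer_of x < h)%N -> #|im x| = a) /\
  (forall x : G, (0 < layer_of x)%N -> #|inv_im x| = b).

(** Every layer must be inhabited, not just layer 0, because reversal exchanges layer 0 with layer
    h. *)
Definition realizable (h : nat) (C : rat) : Prop :=
  exists (G : layered_graph h) (a b : nat),
    [/\ commutative_graph G, biregular G a b,
        forall i : 'I_h.+1, exists x : G, layer_of x = i,
        (0 < a)%N && (0 < b)%N & C = a%:R / b%:R].

(** * Magnification ratios of biregular graphs *)

Section Magnification.
Variables (h : nat) (G : layered_graph h).
Implicit Types (Z : {set G}) (i : nat).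

Lemma in_layer i (x : G) : (x \in layer G i) = (layer_of x == i :> nat).
Proof. by rewrite inE. Qed.

Lemma iter_im0 Z : iter_im 0 Z = Z.
Proof.
apply/setP=> v; rewrite inE; apply/exists_inP/idP=> [[z zZ] | vZ].
  by case/existsP=> p; rewrite (tuple0 p) /= => /eqP <-.
by exists v => //; apply/existsP; exists [tuple]; rewrite /= eqxx.
Qed.

Lemma iter_imS i Z : iter_im i.+1 Z = \bigcup_(x in iter_im i Z) im x.
Proof.
apply/setP=> v; rewrite inE; apply/exists_inP/bigcupP.
  case=> z zZ /existsP[p]; case/tupleP: p => y p.
  have sz : size (belast y p) = i by rewrite size_belast size_tuple.
  have -> : [tuple of y :: p] = rcons (belast y p) (last y p) :> seq G.
    by rewrite -lastI.
  rewrite rcons_path last_rcons => /andP[/andP[pth elast] /eqP <-].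
  exists (last z (belast y p)); last by rewrite inE.
  rewrite inE; apply/exists_inP; exists z => //; apply/existsP.
  by exists (Tuple (introT eqP sz)); rewrite /= pth eqxx.
case=> x; rewrite inE => /exists_inP[z zZ /existsP[p /andP[pth /eqP lastx]]].
rewrite inE => exv; exists z => //; apply/existsP.
exists [tuple of rcons p v].
by rewrite /= rcons_path last_rcons lastx pth exv eqxx.
Qed.

Variables (a b : nat).
Hypothesis reg : biregular G a b.
Hypothesis b_gt0 : (0 < b)%N.

Lemma im_layer {l : nat} {x y : G} :
  x \in layer G l -> edge x y -> y \in layer G l.+1.
Proof. by rewrite !in_layer => /eqP <- /edge_layer ->. Qed.

Lemma iter_im_layer i Z :
  Z \subset layer G 0 -> iter_im i Z \subset layer G i.
Proof.
move=> Z0; elim: i => [|i IHi]; first by rewrite iter_im0.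
rewrite iter_imS; apply/bigcupsP=> x /(subsetP IHi) xi.
by apply/subsetP=> y; rewrite inE; apply: im_layer.
Qed.

Lemma card_edges_from l Z : (l < h)%N -> Z \subset layer G l ->
  (\sum_(x in Z) \sum_(y in \bigcup_(z in Z) im z) edge x y = #|Z| * a)%N.
Proof.
move=> lh Zl; rewrite -sum_nat_const; apply: eq_bigr => x xZ.
have xl : layer_of x = l :> nat.
  by apply/eqP; rewrite -in_layer; exact: (subsetP Zl).
rewrite -(proj1 reg x); last by rewrite xl.
rewrite -sum1_card big_mkcond [RHS]big_mkcond /=; apply: eq_bigr => y _.
rewrite [y \in im x]inE; case: ifP => [_|/negbT/bigcupP nin]; first by case: (edge x y).
by case: ifP => // exy; case: nin; exists x; rewrite ?inE.
Qed.

(** Each vertex of Z emits a edges, and each vertex of the image receives at most b of them, as some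
    of its in-neighbours may lie outside Z. *)
Lemma leq_card_im l Z : (l < h)%N -> Z \subset layer G l ->
  (#|Z| * a <= #|\bigcup_(z in Z) im z| * b)%N.
Proof.
move=> lh Zl; rewrite -(card_edges_from lh Zl) exchange_big /= -sum_nat_const.
apply: leq_sum => y /bigcupP[z zZ]; rewrite inE => ezy.
have y_gt0 : (0 < layer_of y)%N by rewrite (edge_layer ezy).
rewrite -(proj2 reg y y_gt0) -sum1_card big_mkcond [leqRHS]big_mkcond /=.
by apply: leq_sum => x _; rewrite inE; case: (x \in Z); case: (edge x y).
Qed.

(** The double count is exact here: all in-neighbours of a vertex of layer l + 1 lie in layer l. *)
Lemma card_layerS l : (l < h)%N -> (#|layer G l| * a = #|layer G l.+1| * b)%N.
Proof.
move=> lh; rewrite -!sum_nat_const.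
transitivity (\sum_(x in layer G l) \sum_(y in layer G l.+1) edge x y)%N.
  apply: eq_bigr => x xl; rewrite -(proj1 reg x); last first.
    by move: xl; rewrite in_layer => /eqP ->.
  rewrite -sum1_card big_mkcond [RHS]big_mkcond /=; apply: eq_bigr => y _.
  rewrite [y \in im x]inE; case exy: (edge x y); last by case: ifP.
  by rewrite (im_layer xl exy).
rewrite exchange_big /=; apply: eq_bigr => y yl.
have yE : layer_of y = l.+1 :> nat by apply/eqP; rewrite -in_layer.
rewrite -(proj2 reg y); last by rewrite yE.
rewrite -sum1_card big_mkcond [RHS]big_mkcond /=; apply: eq_bigr => x _.
rewrite [x \in inv_im y]inE; case exy: (edge x y); last by case: ifP.
by rewrite in_layer -eqSS -(edge_layer exy) yE eqxx.
Qed.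

Local Notation C := (a%:R / b%:R : rat).

Let b_neq0 : b%:R != 0 :> rat.
Proof. by rewrite pnatr_eq0 -lt0n. Qed.

Lemma leq_card_iter_im i Z : (i <= h)%N -> Z \subset layer G 0 ->
  C ^+ i * #|Z|%:R <= #|iter_im i Z|%:R.
Proof.
elim: i => [|i IHi] ih Z0; first by rewrite iter_im0 mul1r.
have C_ge0 : 0 <= C by rewrite divr_ge0 ?ler0n.
apply: le_trans (_ : C * #|iter_im i Z|%:R <= _).
  by rewrite exprS -mulrA ler_wpM2l ?IHi // ltnW.
rewrite mulrAC ler_pdivrMr ?ltr0n // -!natrM ler_nat iter_imS mulnC.
by apply: (leq_card_im (l := i)) => //; exact: iter_im_layer.
Qed.

Lemma card_layer i : (i <= h)%N ->
  #|layer G i|%:R = C ^+ i * #|layer G 0|%:R :> rat.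
Proof.
elim: i => [|i IHi] ih; first by rewrite mul1r.
apply: (mulIf b_neq0); rewrite -natrM -card_layerS // natrM IHi ?(ltnW ih) //.
by rewrite exprS; field.
Qed.

Lemma magnification_biregular i :
  layer G 0 != set0 -> (i <= h)%N -> magnification G i = C ^+ i.
Proof.
move=> V0 ih; rewrite /magnification.
have card_gt0 Z : Z != set0 -> 0 < #|Z|%:R :> rat by rewrite ltr0n card_gt0.
(* The first branch checks that the default candidate of the [arg min], layer 0, is admissible. *)
case: arg_minP => [|Z /andP[Zn0 Z0] Zmin]; first by rewrite V0 subxx.
apply/eqP; rewrite eq_le; apply/andP; split.
  (* Upper bound: the i-th image of layer 0 is contained in layer i, whose size is known exactly. *)
  apply: le_trans (Zmin (layer G 0) _) _; first by rewrite V0 subxx.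
  rewrite /mag_quotient ler_pdivrMr ?card_gt0 // -card_layer // ler_nat.
  by apply: subset_leq_card; exact: iter_im_layer.
by rewrite /mag_quotient ler_pdivlMr ?card_gt0 // leq_card_iter_im.
Qed.

End Magnification.

(** * Edge reversal and inverse ratios *)

Section Reverse.
Variables (h : nat) (G : layered_graph h).

Lemma rev_edge_layer (u v : G) :
  edge v u -> rev_ord (layer_of v) = (rev_ord (layer_of u)).+1 :> nat.
Proof.
move=> /edge_layer e; rewrite /= !subSS e subnSK // -ltnS -e.
exact: ltn_ord.
Qed.

Definition reverse_graph : layered_graph h :=
  LayeredGraph (layer_of := fun x : G => rev_ord (layer_of x)) rev_edge_layer.

(** The upward and downward conditions are dual: reversal swaps them and keeps the same
    injections. *)
Lemma reverse_commutative : commutative_graph G -> commutative_graph reverse_graph.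
Proof.
move=> [up down]; split=> u v uv.
  have [psi [psiS psiI psiE]] := down v u uv; exists psi.
  split=> [x|x y|x]; rewrite ?inE => vx.
  - by have := psiS x; rewrite !inE; exact.
  - by move=> vy; apply: psiI; rewrite inE.
  - by apply: psiE; rewrite inE.
have [phi [phiS phiI phiE]] := up v u uv; exists phi.
split=> [x|x y|x]; rewrite ?inE => vx.
- by have := phiS x; rewrite !inE; exact.
- by move=> vy; apply: phiI; rewrite inE.
- by apply: phiE; rewrite inE.
Qed.

Lemma reverse_biregular a b : biregular G a b -> biregular reverse_graph b a.
Proof.
move=> [out inn]; split=> x /= xl.
  rewrite -(inn x); first by apply: eq_card => y; rewrite !inE.
  by move: xl; rewrite subSS lt0n; apply: contraTneq => ->; rewrite subn0 ltnn.
rewrite -(out x); first by apply: eq_card => y; rewrite !inE.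
by move: xl; rewrite subSS subn_gt0.
Qed.

End Reverse.

Lemma realizableV h C : realizable h C -> realizable h C^-1.
Proof.
move=> [G [a [b [comm reg ne /andP[a0 b0] ->]]]].
exists (reverse_graph G), b, a; split.
- exact: reverse_commutative.
- exact: reverse_biregular.
- by move=> i; have [x xi] := ne (rev_ord i); exists x; rewrite /= xi rev_ordK.
- by rewrite a0 b0.
- by rewrite invf_div.
Qed.

(** * Layerwise products and products of ratios *)

Section Product.
Variables (h : nat) (G H : layered_graph h).

Definition prod_vertex : finType :=
  {p : vertex G * vertex H | layer_of p.1 == layer_of p.2}.

Definition prod_layer (x : prod_vertex) : 'I_h.+1 := layer_of (val x).1.

Definition prod_edge (x y : prod_vertex) : bool :=
  edge (val x).1 (val y).1 && edge (val x).2 (val y).2.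

Lemma prod_edge_layer x y :
  prod_edge x y -> prod_layer y = (prod_layer x).+1 :> nat.
Proof. by case/andP=> /edge_layer. Qed.

Definition prod_graph : layered_graph h := LayeredGraph prod_edge_layer.

Lemma prod_layer2 (x : prod_graph) : layer_of (val x).2 = layer_of x.
Proof. by apply/esym/eqP; exact: (valP x). Qed.

Lemma val_insub_prod (d : prod_graph) (x : G) (y : H) :
  layer_of x = layer_of y -> val (insubd d (x, y) : prod_graph) = (x, y).
Proof. by move=> xy; apply: insubdK; exact/eqP. Qed.

Lemma prod_commutative :
  commutative_graph G -> commutative_graph H -> commutative_graph prod_graph.
Proof.
move=> [upG downG] [upH downH]; split=> u v /andP[e1 e2].
  have [f [fS fI fE]] := upG _ _ e1; have [g [gS gI gE]] := upH _ _ e2.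
  (* The injections act coordinatewise. The default [u] is never reached on [im v]: both components
     lie one layer above [u], so the pair is a vertex. *)
  pose phi (x : prod_graph) : prod_graph := insubd u (f (val x).1, g (val x).2).
  have val_phi x : x \in im v -> val (phi x) = (f (val x).1, g (val x).2).
    rewrite inE => /andP[vx1 vx2]; apply: val_insub_prod; apply: ord_inj.
    have := fS (val x).1; rewrite !inE => /(_ vx1) /edge_layer ->.
    have := gS (val x).2; rewrite !inE => /(_ vx2) /edge_layer ->.
    by rewrite prod_layer2.
  exists phi; split=> [x xv|x y xv yv|x xv].
  - move: (xv); rewrite !inE => /andP[vx1 vx2]; rewrite /edge /= /prod_edge val_phi //.
    have := fS (val x).1; rewrite !inE => /(_ vx1) ->.
    by have := gS (val x).2; rewrite !inE => /(_ vx2) ->.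
  - move/(congr1 val); rewrite !val_phi // => -[eqf eqg].
    move: xv yv; rewrite !inE => /andP[vx1 vx2] /andP[vy1 vy2].
    have e1' : (val x).1 = (val y).1 by apply: fI; rewrite ?inE.
    have e2' : (val x).2 = (val y).2 by apply: gI; rewrite ?inE.
    by apply: val_inj; case: (val x) (val y) e1' e2' => ? ? [? ?] /= -> ->.
  - move: (xv); rewrite !inE => /andP[vx1 vx2]; rewrite /edge /= /prod_edge val_phi //.
    by rewrite fE ?gE ?inE.
have [f [fS fI fE]] := downG _ _ e1; have [g [gS gI gE]] := downH _ _ e2.
pose psi (x : prod_graph) : prod_graph := insubd u (f (val x).1, g (val x).2).
have val_psi x : x \in inv_im u -> val (psi x) = (f (val x).1, g (val x).2).
  rewrite inE => /andP[ux1 ux2]; apply: val_insub_prod; apply: ord_inj.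
  have := fE (val x).1; rewrite !inE => /(_ ux1) /edge_layer ->.
  have := gE (val x).2; rewrite !inE => /(_ ux2) /edge_layer ->.
  by rewrite prod_layer2.
exists psi; split=> [x xu|x y xu yu|x xu].
- move: (xu); rewrite !inE => /andP[ux1 ux2]; rewrite /edge /= /prod_edge val_psi //.
  have := fS (val x).1; rewrite !inE => /(_ ux1) ->.
  by have := gS (val x).2; rewrite !inE => /(_ ux2) ->.
- move/(congr1 val); rewrite !val_psi // => -[eqf eqg].
  move: xu yu; rewrite !inE => /andP[ux1 ux2] /andP[uy1 uy2].
  have e1' : (val x).1 = (val y).1 by apply: fI; rewrite ?inE.
  have e2' : (val x).2 = (val y).2 by apply: gI; rewrite ?inE.
  by apply: val_inj; case: (val x) (val y) e1' e2' => ? ? [? ?] /= -> ->.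
- move: (xu); rewrite !inE => /andP[ux1 ux2]; rewrite /edge /= /prod_edge val_psi //.
  by rewrite fE ?gE ?inE.
Qed.

(** The second hypothesis makes every pair in B x D a vertex; [d] is the default that [insubd] asks
    for. *)
Lemma card_prod_set (d : prod_graph) (A : {set prod_graph}) (B : {set G}) (D : {set H}) :
  (forall x, (x \in A) = ((val x).1 \in B) && ((val x).2 \in D)) ->
  (forall x y, x \in B -> y \in D -> layer_of x = layer_of y) ->
  #|A| = (#|B| * #|D|)%N.
Proof.
move=> memA same; rewrite -cardsX -(card_imset _ val_inj); apply: eq_card => -[x y].
apply/imsetP/setXP=> [[p pA p_xy] | [xB yD]].
  by move: pA; rewrite memA -p_xy => /andP[].
have valxy := val_insub_prod d (same _ _ xB yD).
by exists (insubd d (x, y)); rewrite ?memA ?valxy ?xB.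
Qed.

Lemma prod_biregular a b c d :
  biregular G a b -> biregular H c d -> biregular prod_graph (a * c) (b * d).
Proof.
move=> [outG inG] [outH inH]; split=> x xl.
  rewrite -(outG (val x).1 xl) -(outH (val x).2); last by rewrite prod_layer2.
  apply: (card_prod_set x) => [y|y z]; first by rewrite !inE.
  rewrite !inE => /edge_layer e1 /edge_layer e2; apply: ord_inj.
  by rewrite e1 e2 prod_layer2.
rewrite -(inG (val x).1 xl) -(inH (val x).2); last by rewrite prod_layer2.
apply: (card_prod_set x) => [y|y z]; first by rewrite !inE.
rewrite !inE => /edge_layer e1 /edge_layer e2; apply: ord_inj.
by apply: succn_inj; rewrite -e1 -e2 prod_layer2.
Qed.

End Product.

Lemma realizableM h C D : realizable h C -> realizable h D -> realizable h (C * D).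
Proof.
move=> [G [a [b [commG regG neG /andP[a0 b0] ->]]]].
move=> [H [c [d [commH regH neH /andP[c0 d0] ->]]]].
exists (prod_graph G H), (a * c)%N, (b * d)%N; split.
- exact: prod_commutative.
- exact: prod_biregular.
- move=> i; have [x xi] := neG i; have [y yi] := neH i.
  have xy : layer_of (x, y).1 == layer_of (x, y).2 by rewrite /= xi yi.
  by exists (Sub (x, y) xy); rewrite /= /prod_layer SubK.
- by rewrite !muln_gt0 a0 b0 c0.
- by rewrite !natrM mulf_div.
Qed.

(** * The word graph of ratio (m + 3) / (m + 2) *)

Section WordGraph.
Variables (h m : nat).
Local Notation letter := 'I_m.+3.
Local Notation word := {ffun 'I_h -> letter}.

(** The layer index is stored beside the word because one word can be legal in several layers. *)
Definition word_vertex : finType :=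
  {p : 'I_h.+1 * word | [forall j : 'I_h, (p.1 <= j)%N ==> (p.2 j != 0)]}.

Definition word_layer (x : word_vertex) : 'I_h.+1 := (val x).1.

Definition word_edge (x y : word_vertex) : bool :=
  (word_layer y == (word_layer x).+1 :> nat) &&
  [forall j : 'I_h, (j < word_layer x)%N ==> ((val x).2 j != (val y).2 j)].

Lemma word_edge_layer x y :
  word_edge x y -> word_layer y = (word_layer x).+1 :> nat.
Proof. by case/andP=> /eqP. Qed.

Definition word_graph : layered_graph h := LayeredGraph word_edge_layer.

Local Notation letters x := (val x).2.

Lemma word_edgeP {x y : word_graph} :
  reflect (layer_of y = (layer_of x).+1 :> nat /\
           forall j : 'I_h, (j < layer_of x)%N -> letters x j != letters y j)
          (edge x y).
Proof.
apply: (iffP andP) => [[/eqP xy /forallP ne]|[/eqP xy ne]].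
  by split=> // j; exact/implyP.
by split=> //; apply/forallP=> j; exact/implyP/ne.
Qed.

Lemma word_neq0 (x : word_graph) (j : 'I_h) :
  (layer_of x <= j)%N -> letters x j != 0.
Proof. by have /forallP/(_ j)/implyP := valP x; exact. Qed.

Lemma word_eq (x y : word_graph) :
  layer_of x = layer_of y -> letters x =1 letters y -> x = y.
Proof.
move=> xy /ffunP; case: x y xy => [[i w] ?] [[i' w'] ?]; rewrite /= /word_layer /=.
by move=> ii' ww'; apply: val_inj; rewrite /= ii' ww'.
Qed.

Lemma val_insub_word (d : word_graph) (i : 'I_h.+1) (w : word) :
  (forall j : 'I_h, (i <= j)%N -> w j != 0) ->
  val (insubd d (i, w) : word_graph) = (i, w).
Proof.
by move=> wP; apply: insubdK; apply/forallP=> j; exact/implyP/wP.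
Qed.

(** Neighbourhoods are boxes inside one layer; the first hypothesis ensures that every word of the
    box is a vertex of layer i. *)
Lemma card_word_set (A : {set word_graph}) (i : 'I_h.+1) (F : 'I_h -> {set letter}) :
  (forall j : 'I_h, (i <= j)%N -> 0 \notin F j) ->
  (forall x, (x \in A) = (layer_of x == i) && [forall j : 'I_h, letters x j \in F j]) ->
  #|A| = (\prod_(j < h) #|F j|)%N.
Proof.
move=> F0 memA; transitivity #|family F|; last first.
  by rewrite card_family foldrE big_map -big_enum.
rewrite -(card_in_imset (f := fun x : word_graph => letters x)).
  apply: eq_card => w; apply/imsetP/familyP=> [[x] | wF].
    by rewrite memA => /andP[_ /forallP xF] -> j; exact: xF.
  have wP : [forall j : 'I_h, ((i, w).1 <= j)%N ==> ((i, w).2 j != 0)].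
    apply/forallP=> j; apply/implyP=> ij; apply: contraNneq (F0 j ij) => <-.
    exact: wF.
  exists (Sub (i, w) wP); last by rewrite SubK.
  rewrite memA /= /word_layer !SubK eqxx; apply/forallP=> j; exact: wF.
move=> x y; rewrite !memA => /andP[/eqP xi _] /andP[/eqP yi _] /ffunP xy.
by apply: word_eq; rewrite // xi yi.
Qed.

Lemma card_neq (c : letter) : #|[set~ c]| = m.+2.
Proof. by rewrite cardsC1 card_ord. Qed.

Lemma prod_nat_cond (l : 'I_h) (c d : nat) :
  (\prod_(j < h) (if j == l then c else d) = c * d ^ h.-1)%N.
Proof.
rewrite (bigD1 l) //= eqxx; congr (_ * _)%N.
under eq_bigr => j jl do rewrite (negPf jl).
by rewrite prod_nat_const cardC1 card_ord.
Qed.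

(** Going forward from layer l, letter l becomes free (m + 3 choices), while each other letter
    avoids one value: the old letter before l, zero after l. Going backward from layer l + 1, every
    letter avoids one value. *)
Lemma word_biregular :
  biregular word_graph (m.+3 * m.+2 ^ h.-1) (m.+2 * m.+2 ^ h.-1).
Proof.
split=> x xl.
  pose l := Ordinal xl.
  pose F (j : 'I_h) : {set letter} :=
    if j == l then setT else [set~ if (j < l)%N then letters x j else 0].
  rewrite (@card_word_set _ (inord l.+1) F) => [||y].
  - rewrite -(prod_nat_cond l); apply: eq_bigr => j _; rewrite /F.
    by case: eqP; rewrite ?cardsT ?card_ord ?card_neq.
  - move=> j; rewrite inordK ?ltnS // => lj; rewrite /F -val_eqE /=.
    by rewrite gtn_eqF // ltnNge ltnW // !inE eqxx.
  rewrite inE; apply/word_edgeP/andP=> -[yl ne].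
    split; first by rewrite -val_eqE /= inordK ?ltnS //; apply/eqP.
    apply/forallP=> j; rewrite /F -val_eqE /=; case: ltngtP => jl; rewrite !inE //.
      by rewrite eq_sym ne.
    by rewrite word_neq0 // yl.
  split; first by move/eqP: yl => ->; rewrite inordK ?ltnS.
  move=> j jl; move/forallP/(_ j): ne; rewrite /F -val_eqE /= ltn_eqF // jl.
  by rewrite !inE eq_sym.
pose l : nat := (layer_of x).-1.
have lE : layer_of x = l.+1 :> nat by rewrite /l prednK.
have lh : (l < h)%N by rewrite -ltnS -lE.
have inl : (inord l : 'I_h.+1) = l :> nat by rewrite inordK // ltnS ltnW.
pose F (j : 'I_h) : {set letter} := [set~ if (j < l)%N then letters x j else 0].
rewrite (@card_word_set _ (inord l) F) => [||y].
(* The in-degree is (m + 2)^h; one factor is split off to match the shape of the out-degree. *)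
- rewrite -(prod_nat_cond (Ordinal lh)); apply: eq_bigr => j _.
  by rewrite card_neq if_same.
- by move=> j; rewrite inl /F ltnNge => ->; rewrite !inE eqxx.
rewrite inE; apply/word_edgeP/andP=> -[yl ne].
  move: yl; rewrite lE => -[yl].
  split; first by rewrite -val_eqE /= inl yl.
  apply/forallP=> j; rewrite /F; case: ltnP => jl; rewrite !inE.
    by rewrite ne // -yl.
  by rewrite word_neq0 // -yl.
have {}yl : layer_of y = l :> nat by rewrite (eqP yl) inl.
split; first by rewrite lE yl.
move=> j; rewrite yl => jl; move/forallP/(_ j): ne; rewrite /F jl.
by rewrite !inE.
Qed.

(* Being fixed-point free on the nonzero letters, this needs at least three letters. *)
Definition shift_neq0 (c : letter) : letter := if c == -1 then 1 else c + 1.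

Lemma shift_neq0_neq0 c : shift_neq0 c != 0.
Proof.
by rewrite /shift_neq0; case: (eqVneq c (-1)) => [//|]; rewrite -addr_eq0.
Qed.

Lemma shift_neq0_neq c : shift_neq0 c != c.
Proof.
rewrite /shift_neq0; case: (eqVneq c (-1)) => [->|_].
  by rewrite -subr_eq0 opprK -val_eqE.
by rewrite -subr_eq0 addrC addKr oner_eq0.
Qed.

Lemma shift_neq0_inj : {in predC1 0 &, injective shift_neq0}.
Proof.
move=> c d; rewrite !inE /shift_neq0 => c0 d0.
case: (eqVneq c (-1)) (eqVneq d (-1)) => [->|_] [->|_] //.
- by move/esym/eqP; rewrite -subr_eq0 addrK (negPf d0).
- by move/eqP; rewrite -subr_eq0 addrK (negPf c0).
- exact: addIr.
Qed.

(** For an in-neighbour z of v, in layer l, exchange letters below l and keep those above l. At l,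
    the letter of z is nonzero while its image must differ from that of w, so translating by the
    letter of w turns one constraint into the other. *)
Lemma word_downward : downward word_graph.
Proof.
move=> v w /word_edgeP[lw vw].
pose y (z : word_graph) : word := [ffun j : 'I_h =>
  if (j < layer_of z)%N then letters z j + letters w j - letters v j
  else if j == layer_of z :> nat then letters w j + letters z j
  else letters z j].
pose psi z : word_graph := insubd v (layer_of v, y z).
have val_psi z : edge z v -> val (psi z) = (layer_of v, y z).
  move=> /word_edgeP[lv zv]; apply: val_insub_word => j; rewrite lv => zj.
  by rewrite ffunE ltnNge ltnW // gtn_eqF //= word_neq0 // ltnW.
have layer_psi z : edge z v -> layer_of (psi z) = layer_of v.
  by move=> /val_psi e; rewrite /= /word_layer e.
exists psi; split=> [z|z z'|z]; rewrite !inE => e.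
- have /word_edgeP[lv zv] := e.
  apply/word_edgeP; rewrite layer_psi //; split=> // j jv; rewrite val_psi //= ffunE.
  case: ltngtP => jz.
  + by rewrite -subr_eq0 addrAC addrK subr_eq0 zv.
  + by move: jv; rewrite lv ltnS leqNgt jz.
  + by rewrite -subr_eq0 addrAC subrr add0r word_neq0 // jz.
- move=> e' /(congr1 val); rewrite !val_psi // => -[/ffunP yE].
  have lzz' : layer_of z = layer_of z' :> nat.
    by apply: succn_inj; rewrite -(edge_layer e) -(edge_layer e').
  apply: word_eq => [|j]; first exact: ord_inj.
  have := yE j; rewrite !ffunE -lzz'; case: ltngtP => _ //.
  + by move/addIr/addIr.
  + by move/addrI.
- have /word_edgeP[lv zv] := e.
  apply/word_edgeP; rewrite layer_psi //; split=> // j jz; rewrite val_psi //= ffunE jz.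
  by rewrite -addrA -[X in X != _]addr0 (inj_eq (addrI _)) eq_sym subr_eq0 eq_sym vw // lv ltnW.
Qed.

(* Coordinate l+1 may vanish in x but not in a vertex of the layer of v, while
   coordinate l need not vanish anywhere; so the pair (x_l - v_l, x_(l+1)) of
   nonzero * arbitrary is reencoded as arbitrary * nonzero. *)
Lemma word_upward : upward word_graph.
Proof.
move=> u v /word_edgeP[lv uv].
(* If v lies in the last layer, [im v] is empty and any map works. *)
case: (ltnP (layer_of v) h) => [vh | hv]; last first.
  have no_x x : x \in im v -> False.
    by rewrite inE => /word_edgeP[xv _]; move: (ltn_ord (layer_of x)); rewrite xv ltnS ltnNge hv.
  by exists id; split=> [x|x y|x] /no_x.
have uh : (layer_of u < h)%N by rewrite ltnW // -lv.
pose j0 := Ordinal uh; pose j1 := Ordinal vh.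
have j10 : (j1 == j0) = false by rewrite -val_eqE /= lv gtn_eqF.
pose d (x : word_graph) : letter := letters x j0 - letters v j0.
(* Here [j0] and [j1] are positions l and l + 1, with l the layer of u. In both branches y_l - v_l -
   y_(l+1) = x_(l+1), so the new pair reveals the branch and can be decoded. *)
pose y (x : word_graph) : word := [ffun j : 'I_h =>
  if (j < layer_of u)%N then letters u j + letters x j - letters v j
  else if j == j0 then
    if letters x j1 == 0 then letters v j0 + shift_neq0 (d x)
    else letters x j0 + letters x j1
  else if j == j1 then if letters x j1 == 0 then shift_neq0 (d x) else d x
  else letters x j].
have y0 x : y x j0 = if letters x j1 == 0 then letters v j0 + shift_neq0 (d x)
                     else letters x j0 + letters x j1.
  by rewrite ffunE ltnn eqxx.
have y1 x : y x j1 = if letters x j1 == 0 then shift_neq0 (d x) else d x.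
  by rewrite ffunE j10 eqxx /= lv ltnNge leqnSn.
have d_neq0 x : edge v x -> d x != 0.
  by move=> /word_edgeP[_ vx]; rewrite subr_eq0 eq_sym vx //= lv.
pose phi x : word_graph := insubd v (layer_of v, y x).
have val_phi x : edge v x -> val (phi x) = (layer_of v, y x).
  move=> e; have /word_edgeP[lx vx] := e; apply: val_insub_word => j vj.
  have [->|jj1] := eqVneq j j1.
    by rewrite y1; case: ifP => _; rewrite ?shift_neq0_neq0 ?d_neq0.
  have uj : (layer_of u < j)%N by rewrite -lv.
  have jj0 : (j == j0) = false by rewrite -val_eqE /= gtn_eqF.
  rewrite ffunE ltnNge (ltnW uj) /= jj0 (negPf jj1) word_neq0 // lx.
  by rewrite ltn_neqAle vj eq_sym andbT.
have layer_phi x : edge v x -> layer_of (phi x) = layer_of v.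
  by move=> /val_phi e; rewrite /= /word_layer e.
exists phi; split=> [x|x x'|x]; rewrite !inE => e.
- have /word_edgeP[lx vx] := e.
  apply/word_edgeP; rewrite layer_phi //; split=> // j ju; rewrite val_phi //= ffunE ju.
  by rewrite -addrA -[X in X != _]addr0 (inj_eq (addrI _)) eq_sym subr_eq0 eq_sym vx // lv ltnW.
- move=> e' /(congr1 val); rewrite !val_phi // => -[yE].
  have lxx' : layer_of x = layer_of x' :> nat.
    by rewrite (edge_layer e) (edge_layer e').
  have [eq0 eq1] : letters x j0 = letters x' j0 /\ letters x j1 = letters x' j1.
    have := congr1 (fun w : word => w j0) yE; have := congr1 (fun w : word => w j1) yE.
    have xd (z : word_graph) : letters z j0 = letters v j0 + d z by rewrite addrC subrK.
    rewrite /= !y0 !y1 (xd x) (xd x').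
    (* The two mixed cases are contradictory: the equations force the letter assumed nonzero at [j1]
       to vanish. *)
    case: eqP => [x0|x_neq0]; case: eqP => [x'0|x'_neq0].
    + by move/(shift_neq0_inj (d_neq0 _ e) (d_neq0 _ e')) => ->; rewrite x0 x'0.
    + move=> -> /eqP; rewrite -addrA (inj_eq (addrI _)) -subr_eq0 opprD addrA subrr add0r.
      by rewrite oppr_eq0 => /eqP.
    + move=> <- /esym/eqP; rewrite -addrA (inj_eq (addrI _)) -subr_eq0 opprD addrA subrr add0r.
      by rewrite oppr_eq0 => /eqP.
    + by move=> -> /addrI ->.
  apply: word_eq => [|j]; first exact: ord_inj.
  have := congr1 (fun w : word => w j) yE; rewrite !ffunE; case: ltnP => _.
    by move/addIr/addrI.
  by case: eqP => [->//|_]; case: eqP => [->//|_].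
- have /word_edgeP[lx vx] := e.
  apply/word_edgeP; rewrite layer_phi //; split=> // j jv; rewrite val_phi //=.
  have [->|jj0] := eqVneq j j0.
    rewrite y0; case: (eqVneq (letters x j1) 0) => [_|x_neq0].
      by rewrite eq_sym addrC -subr_eq eq_sym shift_neq0_neq.
    by rewrite -[X in _ != X]addr0 (inj_eq (addrI _)).
  have ju : (j < layer_of u)%N by rewrite ltn_neqAle -ltnS -lv jv andbT.
  rewrite ffunE ju [letters u j + _]addrC -addrA -[X in _ != X]addr0 (inj_eq (addrI _)).
  by rewrite subr_eq0 uv.
Qed.

Lemma word_commutative : commutative_graph word_graph.
Proof. by split; [exact: word_upward | exact: word_downward]. Qed.

Lemma word_layer_neq0 (i : 'I_h.+1) : exists x : word_graph, layer_of x = i.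
Proof.
have wP : [forall j : 'I_h, ((i, [ffun=> 1%R] : word).1 <= j)%N ==>
                            ((i, [ffun=> 1%R] : word).2 j != 0)].
  by apply/forallP=> j; rewrite /= ffunE oner_eq0 implybT.
by exists (Sub (i, [ffun=> 1]) wP); rewrite /= /word_layer SubK.
Qed.

End WordGraph.

(** * From the generators to all positive rationals *)

Lemma realizable_succ h m : realizable h (m.+3%:R / m.+2%:R).
Proof.
exists (word_graph h m), (m.+3 * m.+2 ^ h.-1)%N, (m.+2 * m.+2 ^ h.-1)%N; split.
- exact: word_commutative.
- exact: word_biregular.
- exact: word_layer_neq0.
- by rewrite !muln_gt0 expn_gt0.
- by rewrite !natrM -mulf_div divff ?mulr1 // pnatr_eq0 expn_eq0.
Qed.

(** The denominator is 2 because the available factors start at 3/2. The base case is 1 =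
    (3/2)(2/3), and each further factor (n + 3) / (n + 2) telescopes. *)
Lemma realizable_half h n : realizable h (n.+2%:R / 2%:R).
Proof.
elim: n => [|n IHn].
  have := realizableM (realizable_succ h 0) (realizableV (realizable_succ h 0)).
  by rewrite divff // divff.
have := realizableM (realizable_succ h n) IHn.
by rewrite mulrA divfK ?pnatr_eq0.
Qed.

Lemma realizable_gt0 h C : 0 < C -> realizable h C.
Proof.
move=> C_gt0.
have [a a_gt0 numC] : exists2 a, (0 < a)%N & numq C = a%:Z.
  exists `|numq C|%N; first by rewrite absz_gt0 numq_eq0 gt_eqF.
  by rewrite gez0_abs // numq_ge0 ltW.
have [b b_gt0 denC] : exists2 b, (0 < b)%N & denq C = b%:Z.
  by exists `|denq C|%N; rewrite ?absz_gt0 ?denq_eq0 // gez0_abs // denq_ge0.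
(* An integer k is written as 2k / 2. *)
have half k : (0 < k)%N -> realizable h k%:R.
  case: k => // k _; have := realizable_half h k.*2.
  by rewrite -doubleS -muln2 natrM mulfK ?pnatr_eq0.
rewrite -[C]divq_num_den numC denC -!pmulrn.
by apply: realizableM; [exact: half | apply: realizableV; exact: half].
Qed.

Theorem theorem2 (C : rat) (h : nat) (C_gt0 : 0 < C) (h_gt0 : (0 < h)%N) :
  exists G : layered_graph h,
    [/\ commutative_graph G,
        layer G 0 != set0
      & forall i : nat, (1 <= i <= h)%N -> magnification G i = C ^+ i].
Proof.
have [G [a [b [comm reg ne /andP[_ b_gt0] ->]]]] := realizable_gt0 h C_gt0.
have V0 : layer G 0 != set0.
  by have [x x0] := ne ord0; apply/set0Pn; exists x; rewrite in_layer x0.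
exists G; split=> // i /andP[_ ih]; exact: magnification_biregular.
Qed.
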